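(* Let $L\subseteq\mathbb R^n$ be a convex body and $K\in\mathscr K(\mathbb R^n)$ such that $K\subseteq L$. Let $\mu=(\mu_j)_{j\ge1}$ be an admissible weight satisfying $\mu_j\ge j$ for $j\ge1$. Let $M_0>b_0>0$. Assume that $(\mu,M_0,a_K,b_0)$ is admissible and let $\mathbf N=\mathbf N(\mu,M_0,a_K,b_0)$. Let $f:L\to\mathbb R$ be a $(\mu^{|\mathbf N},M_0)$-smooth function satisfying $\|f\|_K\ge b_0$. For $t>0$ let $K_t:=\{x\in K:|f(x)|\le t\}$. Then $$|K_t|\le\frac{|K|}{\nu_K}\Big(\frac{\mathbf C_{\mathbf N}\,t}{\|f\|_K}\Big)^{1/\mathbf N},\qquad t>0.$$
   Context: $|E|$ denotes Lebesgue measure. A convex body is a compact convex set with nonempty interior. Weights and smoothness. An admissible weight is a sequence $\mu=(\mu_j)_{j\ge1}$ of reals with $0<\mu_1\le\mu_2\le\cdots$. Given $M_0>0$ put $M_j=M_0\mu_1\cdots\mu_j$, $j\ge1$. For $N\in\mathbb N_{\ge1}\cup\{\infty\}$ and nonempty compact $L\subseteq\mathbb R^n$, a map $f=(f_1,\dots,f_m):L\to\mathbb R^m$ is $(\mu^{|N},M_0)$-smooth if it is of class $C^N$ in some open neighborhood of $L$ and $\sup_{x\in L}\sum_{i=1}^m\sum_{|\alpha|=j}\frac{j!}{\alpha!}|\partial^\alpha f_i(x)|\le M_j$ for all integers $0\le j<N+1$. Also $\|f\|_E:=\sup_{x\in E}\sum_{i=1}^m|f_i(x)|$. Degree. For $A,a,b>0$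 let $j_0$ be the smallest nonnegative integer $\ge\log(A/b)$. The tuple $(\mu,A,a,b)$ is admissible if $\sum_{j=j_0+1}^\infty 1/\mu_j>a\,e$; then $\mathbf N(\mu,A,a,b):=2\sup\{k\in\mathbb N:\sum_{j=j_0+1}^k\frac1{a\mu_j}<e\}$ (empty sums are $0$). The constant $\mathbf C_{\mathbf N}$. Fix an increasing continuous, (piecewise) $C^1$ function $\tilde\mu:[1,\infty)\to(0,\infty)$ with $\tilde\mu(j)=\mu_j$ for integers $j\ge1$ (left derivatives are used at points of nondifferentiability), put $\gamma_{\tilde\mu}(k):=\sup_{1\le s\le k}\frac{s\tilde\mu'(s)}{\tilde\mu(s)}$, and $\mathbf C_{\mathbf N}:=(4e^{4+\gamma_{\tilde\mu}(\mathbf N)})^{\mathbf N}$. Admissible sets. A family $(K_w,a_w,\Upsilon_w)_{w\in W}$, where $W$ is any set, $K_w\subseteq[0,1]^n$ is compact, $a_w\in K_w$, and $\Upsilon_w:[0,\infty)^n\to\mathbb R^n$ is a map, is an admissible collection of degree $d\in\mathbb N_{\ge1}$ if there are constants $\delta_1,\delta_2,\delta_3>0$, $q\in\mathbb N_{\ge1}$ and polynomial maps $R_w:\mathbb R^n\to\mathbb R^n$ of degree at most $d$ such that for all $w\in W$: (1) $K_w$ is star-shaped with respect to $a_w$ and $|K_w|\ge\delta_1$; (2) $\Upsilon_w(x_1,\dots,x_n)=R_w(x_1^{1/q},\dots,x_n^{1/q})$; (3) $\delta_2\le\sum_\kappa|c_{w,\kappa}|\le\delta_3$, where $c_{w,\kappa}$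 are the coefficients of the polynomial $\operatorname{Jac}(R_w)$ (the Jacobian determinant); (4) writing $a_w=(a_{w,1},\dots,a_{w,n})$, $a_{w,i}=0$ whenever $\Upsilon_w$ is not a polynomial map with respect to the variable $x_i$. A nonempty compact set $K\subseteq\mathbb R^n$ is admissible (of degree $d$) if there is an admissible collection (of degree $d$) $(K_w,a_w,\Upsilon_w)_{w\in K}$ indexed by $K$ with $\Upsilon_w(a_w)=w$ for each $w\in K$ and $K=\bigcup_{w\in K}\Upsilon_w(K_w)$. $\mathscr K(\mathbb R^n)$ is the family of all admissible sets. For each $K\in\mathscr K(\mathbb R^n)$ such a collection and its degree $d$ are fixed ($d=1$ if $K$ is a convex body), and $$a_K:=4\,\tfrac{(d+1)^{d+1}}{(d-1)^{d-1}}\max\{\operatorname{diam}(K),1\}\ \text{ if }d\ge2,\qquad a_K:=\operatorname{diam}(K)\ \text{ if }d=1.$$ The constant $\nu_K$. For $K\in\mathscr K(\mathbb R^n)$, $\nu_K\in(0,1]$ denotes a fixed constant depending only on $K$ (with $\nu_K=1/n$ if $K$ is a convex body) for which the paper's Remez inequality holds: for every convex body $L\supseteq K$, every admissible weight $\mu$ with $\mu_j\ge j$, all $M_0>b_0>0$ and $m\ge1$ with $(\mu,mM_0,a_K,b_0)$ admissible and $\mathbf N'=\mathbf N(\mu,mM_0,a_K,b_0)$, every $(\mu^{|\mathbf N'},M_0)$-smooth $f:L\to\mathbb R^m$ with $\|f\|_K\ge b_0$, and every measurable $E\subseteq K$ with $|E|>0$, $\|f\|_K\le\mathbf C_{\mathbf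 N'}\big(\frac{m|K|^{\nu_K}}{|K|^{\nu_K}-(|K|-|E|)^{\nu_K}}\big)^{\mathbf N'}\|f\|_E$. (Such a constant exists for every $K\in\mathscr K(\mathbb R^n)$.) *)

(* Defs.v *)
From HB Require Import structures.
From mathcomp Require Import all_boot all_order all_algebra.
From mathcomp Require Import all_classical all_reals all_analysis.
(* The notations of mpoly clash with those of analysis. *)
From mathcomp Require mpoly.
Import (canonicals, coercions) mpoly.

Set Implicit Arguments.
Unset Strict Implicit.
Unset Printing Implicit Defensive.

Import Order.TTheory GRing.Theory Num.Theory.
Import numFieldNormedType.Exports.

Local Open Scope classical_set_scope.
Local Open Scope ring_scope.

Section Geometry.
Context {R : realType}.

Definition box n (a b : 'rV[R]_n) : set 'rV[R]_n :=
  [set x | forall i, a 0 i < x 0 i <= b 0 i].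

(* The maximum makes the volume 0 when the box is empty. *)
Definition box_volume n (a b : 'rV[R]_n) : R :=
  \prod_(i < n) Num.max 0 (b 0 i - a 0 i).

(* Lebesgue outer measure. A set E is Lebesgue measurable when
   [lebesgue_rV.-caratheodory E], and lebesgue_rV E is then its measure. *)
Definition lebesgue_rV {n} (A : set 'rV[R]_n) : \bar R :=
  ereal_inf
    [set (\sum_(0 <= k <oo) (box_volume (c k).1 (c k).2)%:E)%E |
      c in [set c : nat -> 'rV[R]_n * 'rV[R]_n |
             A `<=` \bigcup_k box (c k).1 (c k).2]].

Definition convex_body n (L : set 'rV[R]_n) : Prop :=
  [/\ compact L, convex_set (L : set (convex_lmodType 'rV[R]_n))
    & interior L !=set0].

Definition star_shaped n (K : set 'rV[R]_n) (a : 'rV[R]_n) : Prop :=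
  forall x (t : R), K x -> 0 <= t <= 1 -> K (a + t *: (x - a)).

Definition eucl_dist n (x y : 'rV[R]_n) : R :=
  Num.sqrt (\sum_(i < n) (x 0 i - y 0 i) ^+ 2).

Definition diam n (K : set 'rV[R]_n) : R :=
  sup [set eucl_dist x y | x in K & y in K].

(* ||f||_E *)
Definition norm_on n m (E : set 'rV[R]_n) (f : 'rV[R]_n -> 'rV[R]_m) : R :=
  sup [set \sum_(i < m) `|f x 0 i| | x in E].

End Geometry.

Section Smoothness.
Context {R : realType}.

Definition partial n (i : 'I_n) (g : 'rV[R]_n -> R) : 'rV[R]_n -> R :=
  fun x => 'D_(delta_mx 0 i) g x.

Definition partials n (s : seq 'I_n) (g : 'rV[R]_n -> R) : 'rV[R]_n -> R :=
  foldr (@partial n) g s.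

(* class C^N on U, which is meant to be open *)
Definition class_C n (N : nat) (U : set 'rV[R]_n) (g : 'rV[R]_n -> R) : Prop :=
  forall s : seq 'I_n, (size s <= N)%N -> forall x, U x ->
    {for x, continuous (partials s g)} /\
    ((size s < N)%N -> forall i, derivable (partials s g) x (delta_mx 0 i)).

Definition partial_multi n (al : 'I_n -> nat) (g : 'rV[R]_n -> R) :
    'rV[R]_n -> R :=
  foldr (fun i h => iter (al i) (partial i) h) g (enum 'I_n).

(* A weight (mu_j)_{j >= 1} is a function on nat whose value at 0 is unused. *)
Definition admissible_weight (mu : nat -> R) : Prop :=
  0 < mu 1%N /\ forall j, (1 <= j)%N -> mu j <= mu j.+1.

Definition weight_prod (mu : nat -> R) (M0 : R) (j : nat) : R :=
  M0 * \prod_(1 <= i < j.+1) mu i.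

(* Only the values of f near L matter. The multi-indices of length j are the
   functions 'I_n -> {0, ..., j} of sum j. *)
Definition smooth n m (mu : nat -> R) (N : nat) (M0 : R)
    (L : set 'rV[R]_n) (f : 'rV[R]_n -> 'rV[R]_m) : Prop :=
  (exists U : set 'rV[R]_n,
     [/\ open U, L `<=` U & forall i, class_C N U (fun x => f x 0 i)]) /\
  forall j, (j <= N)%N -> forall x, L x ->
    \sum_(i < m)
      \sum_(al : {ffun 'I_n -> 'I_j.+1} | (\sum_(k < n) al k)%N == j)
        (j`!%:R / (\prod_(k < n) (al k)`!)%:R)
          * `|partial_multi (fun k => al k) (fun y => f y 0 i) x|
    <= weight_prod mu M0 j.

End Smoothness.

Section Degree.
Context {R : realType}.

Definition j_start (A b : R) : nat :=
  infimum 0%N [set j : nat | ln (A / b) <= j%:R].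

Definition admissible_tuple (mu : nat -> R) (A a b : R) : Prop :=
  ((a * expR 1)%:E < \sum_((j_start A b).+1 <= j <oo) ((mu j)^-1)%:E)%E.

(* For an admissible tuple the supremum below is that of a nonempty bounded set
   of naturals. *)
Definition degree_N (mu : nat -> R) (A a b : R) : nat :=
  (2 * supremum 0
     [set k : nat |
       (\sum_((j_start A b).+1 <= j < k.+1) (a * mu j)^-1 < expR 1)%R])%N.

End Degree.

Section RemezFactor.
Context {R : realType}.

(* Breakpoints 1 = p_0 < p_1 < ... tending to infinity; on each closed piece g
   is the restriction of a C^1 function on the line. *)
Definition piecewise_C1 (g : R -> R) : Prop :=
  exists p : nat -> R,
    [/\ p 0%N = 1, (forall i, p i < p i.+1), p @ \oo --> +oo
      & forall i, exists h : R -> R,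
          [/\ (forall x, derivable h x 1), continuous (derive1 h)
            & {in `[p i, p i.+1], g =1 h}]].

(* g represents a function [1, oo) -> (0, oo); its values outside [1, oo) are
   unused. *)
Definition interpolates (mu : nat -> R) (g : R -> R) : Prop :=
  [/\ {within `[1, +oo[, continuous g},
      {in `[1, +oo[ &, {homo g : x y / x <= y}},
      {in `[1, +oo[, forall x, 0 < g x},
      piecewise_C1 g
    & forall j, (1 <= j)%N -> g j%:R = mu j].

(* The left derivative is used where g is not differentiable, except at the
   left end 1 of the domain, where only the right derivative makes sense. *)
Definition derivative (g : R -> R) (s : R) : R :=
  if s == 1 then lim ((h^-1 * (g (s + h) - g s)) @[h --> 0^'+])
  else if `[< derivable g s 1 >] then derive1 g s
  else lim ((h^-1 * (g (s + h) - g s)) @[h --> 0^'-]).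

Definition gamma_const (g : R -> R) (k : R) : R :=
  sup [set s * derivative g s / g s | s in `[1, k]].

Definition C_const (g : R -> R) (N : nat) : R :=
  (4 * expR (4 + gamma_const g N%:R)) ^+ N.

End RemezFactor.

Section AdmissibleSets.
Context {R : realType}.

Local Notation mpoly n := (mpoly.mpoly n R).

Definition poly_map n := 'I_n -> mpoly n.

Definition poly_map_eval n (P : poly_map n) (x : 'rV[R]_n) : 'rV[R]_n :=
  \row_j mpoly.meval (fun i => x 0 i) (P j).

(* msize is the total degree plus one, and 0 on the zero polynomial *)
Definition poly_map_degree_le n (P : poly_map n) (d : nat) : Prop :=
  forall j, (mpoly.msize (P j) <= d.+1)%N.

Definition poly_map_Jac n (P : poly_map n) : mpoly n :=
  \det (\matrix_(i, j) mpoly.mderiv j (P i)).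

Definition coef_norm n (p : mpoly n) : R :=
  \sum_(k <- mpoly.msupp p) `|mpoly.mcoeff k p|.

Definition orthant n : set 'rV[R]_n := [set x | forall i, 0 <= x 0 i].

(* Y : [0, oo)^n -> R^n, taken as a total function *)
Definition polynomial_in_var n (Y : 'rV[R]_n -> 'rV[R]_n) (i : 'I_n) : Prop :=
  forall x, orthant x -> forall j, exists p : {poly R}, forall t, 0 <= t ->
    Y (\row_k (if k == i then t else x 0 k)) 0 j = p.[t].

(* The family is indexed by the subset W of T. *)
Definition admissible_collection n (T : Type) (W : set T)
    (Kw : T -> set 'rV[R]_n) (a : T -> 'rV[R]_n)
    (Y : T -> 'rV[R]_n -> 'rV[R]_n) (d : nat) : Prop :=
  (1 <= d)%N /\
  exists (delta1 delta2 delta3 : R) (q : nat) (P : T -> poly_map n),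
    [/\ 0 < delta1, 0 < delta2, 0 < delta3, (1 <= q)%N
      & forall w, W w ->
        [/\ [/\ Kw w `<=` [set x | forall i, 0 <= x 0 i <= 1],
                compact (Kw w), Kw w (a w) & poly_map_degree_le (P w) d],
            star_shaped (Kw w) (a w) /\ (delta1%:E <= lebesgue_rV (Kw w))%E,
            forall x, orthant x ->
              Y w x = poly_map_eval (P w) (\row_i x 0 i `^ q%:R^-1),
            delta2 <= coef_norm (poly_map_Jac (P w)) <= delta3
          & forall i, ~ polynomial_in_var (Y w) i -> a w 0 i = 0]].

Definition admissible_set n (d : nat) (K : set 'rV[R]_n) : Prop :=
  [/\ K !=set0, compact K
    & exists (Kw : 'rV[R]_n -> set 'rV[R]_n) (a : 'rV[R]_n -> 'rV[R]_n)
             (Y : 'rV[R]_n -> 'rV[R]_n -> 'rV[R]_n),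
        [/\ admissible_collection K Kw a Y d,
            forall w, K w -> Y w (a w) = w
          & K = \bigcup_(w in K) (Y w @` Kw w)]].

Definition a_const n (d : nat) (K : set 'rV[R]_n) : R :=
  if (2 <= d)%N then
    4 * ((d.+1 ^ d.+1)%:R / (d.-1 ^ d.-1)%:R) * Num.max (diam K) 1
  else diam K.

(* nu is a possible value of nu_K, where d is the degree fixed for K and
   [tmu mu] is the interpolant fixed for the weight mu. *)
Definition remez_constant n (tmu : (nat -> R) -> R -> R) (d : nat)
    (K : set 'rV[R]_n) (nu : R) : Prop :=
  [/\ 0 < nu <= 1, (convex_body K -> nu = n%:R^-1)
    & forall (L : set 'rV[R]_n) (mu : nat -> R) (M0 b0 : R) (m : nat)
             (f : 'rV[R]_n -> 'rV[R]_m) (E : set 'rV[R]_n),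
        let N := degree_N mu (m%:R * M0) (a_const d K) b0 in
        convex_body L -> K `<=` L ->
        admissible_weight mu -> (forall j, (1 <= j)%N -> j%:R <= mu j) ->
        0 < b0 -> b0 < M0 -> (1 <= m)%N ->
        admissible_tuple mu (m%:R * M0) (a_const d K) b0 ->
        smooth mu N M0 L f -> b0 <= norm_on K f ->
        lebesgue_rV.-caratheodory E -> E `<=` K -> (0 < lebesgue_rV E)%E ->
        let vK := fine (lebesgue_rV K) in
        let vE := fine (lebesgue_rV E) in
        norm_on K f <=
          C_const (tmu mu) N
          * (m%:R * vK `^ nu / (vK `^ nu - (vK - vE) `^ nu)) ^+ N
          * norm_on E f].

End AdmissibleSets.

(* Main.v *)
(* Apply the Remez inequality with m = 1 to E = K_t, on which |f| <= t: with
   r = 1 - (1 - |E|/|K|)^nu it reads ||f||_K <= C_N r^(-N) t, that is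
   r <= (C_N t / ||f||_K)^(1/N), while Bernoulli's inequality for exponents
   nu <= 1 gives r >= nu |E|/|K|. The set K_t is compact, and closed sets are
   Caratheodory measurable because a half-space cuts every box of a cover into
   two boxes whose volumes add up. *)
Require Import Defs.
From HB Require Import structures.
From mathcomp Require Import all_boot all_order all_algebra.
From mathcomp Require Import all_classical all_reals all_analysis.

Set Implicit Arguments.
Unset Strict Implicit.
Unset Printing Implicit Defensive.

Import Order.TTheory GRing.Theory Num.Theory.
Import numFieldNormedType.Exports.

Local Open Scope classical_set_scope.
Local Open Scope ring_scope.

(** * Countable covers by boxes and the outer measure they define *)

Section LebesgueOuterMeasure.
Context {R : realType}.
Local Open Scope ereal_scope.

Lemma box_volume_ge0 n (a b : 'rV[R]_n) : (0 <= box_volume a b)%R.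
Proof. by apply: prodr_ge0 => i _; rewrite le_max lexx. Qed.

(** The dimension is a successor because in dimension 0 the empty product gives every box volume
    1. *)
Lemma box_volume_eq0 n (a : 'rV[R]_n.+1) : box_volume a a = 0%R.
Proof. by rewrite /box_volume big_ord_recl subrr maxxx mul0r. Qed.

Lemma lebesgue_rV_ge0 n (A : set 'rV[R]_n) : 0 <= lebesgue_rV A.
Proof.
apply: le_ereal_inf_tmp => _ [c _ <-]; apply: nneseries_ge0 => k _ _.
by rewrite lee_fin box_volume_ge0.
Qed.

Lemma le_lebesgue_rV n :
  {homo (@lebesgue_rV R n) : A B / A `<=` B >-> A <= B}.
Proof.
move=> A B AB; apply: ereal_inf_le_tmp => _ [c Bc <-].
by exists c => //; exact: subset_trans AB Bc.
Qed.

Lemma lebesgue_rV_box n (a b : 'rV[R]_n.+1) :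
  lebesgue_rV (box a b) <= (box_volume a b)%:E.
Proof.
apply: ereal_inf_lbound.
(* The box itself is the cover, padded by degenerate boxes of volume 0 to an infinite sequence. *)
exists (fun k : nat => if k == 0%N then (a, b) else (0%R, 0%R)) => /=.
  by move=> x abx; exists 0%N.
rewrite (nneseries_split 0 1) ?add0n ?big_nat1 => [|k _]; last first.
  by rewrite lee_fin box_volume_ge0.
rewrite eseries0 ?adde0// => k k0 _.
by rewrite gtn_eqF// box_volume_eq0.
Qed.

Lemma lebesgue_rV0 n : lebesgue_rV (set0 : set 'rV[R]_n.+1) = 0.
Proof.
apply/eqP; rewrite eq_le lebesgue_rV_ge0 andbT.
have -> : 0 = (box_volume (0%R : 'rV[R]_n.+1) 0%R)%:E by rewrite box_volume_eq0.
exact: le_trans (le_lebesgue_rV (@sub0set _ _)) (lebesgue_rV_box _ _).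
Qed.

Lemma lebesgue_rV_cover n (A : set 'rV[R]_n) (e : R) : (0 < e)%R ->
  lebesgue_rV A != +oo -> exists c : nat -> 'rV[R]_n * 'rV[R]_n,
    A `<=` \bigcup_k box (c k).1 (c k).2 /\
    \sum_(k <oo) (box_volume (c k).1 (c k).2)%:E <= lebesgue_rV A + e%:E.
Proof.
move=> e0 Aoo.
have /(lb_ereal_inf_adherent e0)[_ [c Ac <-] /ltW] : lebesgue_rV A \is a fin_num.
  by rewrite ge0_fin_numE ?lebesgue_rV_ge0// ltey.
by exists c.
Qed.

Lemma lebesgue_rV_sigma_subadditive n :
  sigma_subadditive (@lebesgue_rV R n).
Proof.
move=> A; have [[i ioo]|/forallNP Aoo] :=
    pselect (exists i, lebesgue_rV (A i) = +oo).
  rewrite (eseries_pinfty _ _ ioo) ?leey// => k _.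
  by rewrite gt_eqF// (lt_le_trans _ (lebesgue_rV_ge0 _)).
apply/lee_addgt0Pr => e e0.
(* The [i]-th set gets a cover with slack [e / 2 ^ i.+1], so that the total slack is at most [e]. *)
apply: le_trans (epsilon_trick _ _ (ltW e0)); last first.
  by move=> k; exact: lebesgue_rV_ge0.
have /choice[c cP] : forall i, exists c : nat -> 'rV[R]_n * 'rV[R]_n,
    A i `<=` \bigcup_k box (c k).1 (c k).2 /\
    \sum_(k <oo) (box_volume (c k).1 (c k).2)%:E <=
      lebesgue_rV (A i) + (e / (2 ^ i.+1)%:R)%:E.
  move=> i; apply: lebesgue_rV_cover; last exact/eqP.
  by rewrite divr_gt0// ltr0n expn_gt0.
have v0 i j : 0 <= (box_volume (c i j).1 (c i j).2)%:E.
  by rewrite lee_fin box_volume_ge0.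
apply: (@le_trans _ _
    (\sum_(i <oo) \sum_(j <oo) (box_volume (c i j).1 (c i j).2)%:E)); last first.
  by apply: lee_nneseries => [i _ _|i _]; [exact: nneseries_ge0|exact: (cP i).2].
rewrite nneseries_esumT => [|i]; last exact: nneseries_ge0.
rewrite (eq_esum (b := fun i => \esum_(j in [set: nat])
    (box_volume (c i j).1 (c i j).2)%:E)); last first.
  by move=> i _; rewrite nneseries_esumT.
rewrite esum_esum//.
(* A bijection from [nat] to [nat * nat] merges the covers into one sequence; nonnegativity lets the
   double sum be reordered. *)
have /card_esym/card_set_bijP[f fbij] := card_nat2.
rewrite (_ : setT `*`` _ = setT); last by apply/seteqP; split.
rewrite (reindex_esum _ _ _ _ fbij) -nneseries_esumT//.
apply: ereal_inf_lbound; exists (fun k => c (f k).1 (f k).2) => //.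
move=> x [i _ /(cP i).1[j _ xij]].
by have [_ _ /(_ (i, j) Logic.I)[k _ fk]] := fbij; exists k; rewrite // fk.
Qed.

(** This gives access to the sigma-algebra of Caratheodory measurable sets. In dimension 0 the empty
    set would have outer measure [+oo]. *)
HB.instance Definition _ n := isOuterMeasure.Build R 'rV[R]_n.+1
  (@lebesgue_rV R n.+1) (lebesgue_rV0 n) (@lebesgue_rV_ge0 n.+1)
  (@le_lebesgue_rV n.+1) (@lebesgue_rV_sigma_subadditive n.+1).

(** * Caratheodory measurability of closed sets *)

Lemma box_volume_split n (a b : 'rV[R]_n) (i : 'I_n) (s : R) :
  (box_volume a (\row_j if j == i then Num.min (b 0 j) s else b 0 j) +
   box_volume (\row_j if j == i then Num.max (a 0 j) s else a 0 j) b =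
   box_volume a b)%R.
Proof.
have volE (u v : 'rV[R]_n) : box_volume u v = (Num.max 0 (v 0 i - u 0 i) *
    \prod_(j < n | j != i) Num.max 0 (v 0 j - u 0 j))%R.
  by rewrite /box_volume (bigD1 i).
rewrite !volE !mxE eqxx.
under eq_bigr => j ji do rewrite mxE (negbTE ji).
under [X in (_ + _ * X = _)%R]eq_bigr => j ji do rewrite mxE (negbTE ji).
rewrite -mulrDl; congr (_ * _)%R.
(* All factors but the [i]-th are common. A genuine cut occurs only for [a 0 i <= s < b 0 i];
   otherwise at least one piece has side 0 and the other keeps the full factor. *)
have [bs|sb] := leP (b 0%R i) s; have [as_|sa] := leP (a 0%R i) s.
- by rewrite [X in (_ + X)%R]max_l ?addr0// subr_le0.
- by rewrite !max_l ?addr0 ?subr_le0// (le_trans bs (ltW sa)).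
- by rewrite !max_r ?subr_ge0 ?(ltW sb)// ?(le_trans as_ (ltW sb))// addrC subrKA.
- by rewrite [X in (X + _)%R]max_l ?add0r// subr_le0 ltW.
Qed.

(** Cutting each box of a cover of [X] at height [s] yields covers of both parts of [X] without
    changing the total volume. Boxes open on the left and closed on the right match the cut into
    [x 0 i <= s] and [s < x 0 i]. *)
Lemma caratheodory_halfspace n (i : 'I_n.+1) (s : R) :
  lebesgue_rV.-caratheodory [set x : 'rV[R]_n.+1 | (x 0 i <= s)%R].
Proof.
apply: le_caratheodory_measurable => X.
apply: le_ereal_inf_tmp => _ [c Xc <-].
pose lo k := (\row_j if j == i then Num.min ((c k).2 0 j) s else (c k).2 0 j)%R.
pose hi k := (\row_j if j == i then Num.max ((c k).1 0 j) s else (c k).1 0 j)%R.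
under eq_eseriesr => k _ do rewrite -(box_volume_split _ _ i s) EFinD.
rewrite nneseriesD; try by move=> *; rewrite lee_fin box_volume_ge0.
apply: leeD; apply: ereal_inf_lbound.
- exists (fun k => ((c k).1, lo k)) => // x [/Xc[k _ xk] /= xs].
  exists k => // j; rewrite mxE; case: eqP => [->|_]; last exact: xk.
  by have /andP[-> xb] := xk i; rewrite le_min xb.
- exists (fun k => (hi k, (c k).2)) => // x [/Xc[k _ xk] /negP].
  rewrite -ltNge => sx.
  exists k => // j; rewrite mxE; case: eqP => [->|_]; last exact: xk.
  by have /andP[xa ->] := xk i; rewrite gt_max xa sx.
Qed.

Lemma caratheodory_box n (a b : 'rV[R]_n.+1) :
  lebesgue_rV.-caratheodory (box a b).
Proof.
rewrite (_ : box a b = \bigcap_(i in [set: 'I_n.+1])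
    (~` [set x : 'rV_n.+1 | x 0 i <= a 0 i]
       `&` [set x | x 0 i <= b 0 i])%R); last first.
  apply/seteqP; split => x xab i.
    by have /andP[+ xb] := xab i; rewrite ltNge => /negP xa _; split.
  have [/= /negP] := xab i Logic.I; rewrite -ltNge => xa xb.
  by rewrite xa xb.
apply: (@fin_bigcap_measurable _
  (caratheodory_type (@lebesgue_rV R n.+1))) => // i _.
by apply: caratheodory_measurable_setI;
  [apply: caratheodory_measurable_setC|]; exact: caratheodory_halfspace.
Qed.

(** An open set is the union of the boxes with rational corners that it contains, and these are
    countably many. *)
Lemma caratheodory_open n (U : set 'rV[R]_n.+1) :
  open U -> lebesgue_rV.-caratheodory U.
Proof.
move=> oU; pose ratbox (q : 'rV[rat]_n.+1 * 'rV[rat]_n.+1) : set 'rV[R]_n.+1 :=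
  box (map_mx ratr q.1) (map_mx ratr q.2).
rewrite (_ : U = \bigcup_q
    (if `[< ratbox q `<=` U >] then ratbox q else set0)); last first.
  apply/seteqP; split => [x Ux|x [q _]]; last by case: asboolP => // qU /qU.
  have /nbhs_ballP[e /= e0 xeU] : nbhs x U by exact: open_nbhs_nbhs.
  (* Balls are those of the sup norm, so corners chosen coordinatewise within [e] of [x] keep the
     box inside [U]. *)
  have /choice[lo xlo] : forall i, exists q : rat, (x 0 i - e < ratr q < x 0 i)%R.
    move=> i; suff /rat_in_itvoo[q] : (x 0 i - e < x 0 i)%R.
      by rewrite in_itv/=; exists q.
    by rewrite ltrBlDr ltrDl.
  have /choice[hi xhi] : forall i, exists q : rat, (x 0 i < ratr q < x 0 i + e)%R.
    move=> i; suff /rat_in_itvoo[q] : (x 0 i < x 0 i + e)%R.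
      by rewrite in_itv/=; exists q.
    by rewrite ltrDl.
  exists (\row_i lo i, \row_i hi i)%R => //; case: asboolP => [_ i|[]].
    have /andP[_ ?] := xlo i; have /andP[? _] := xhi i.
    by rewrite !mxE/=; apply/andP; split; [|exact: ltW].
  move=> y /= yq; apply: xeU; split=> // i j; rewrite (ord1 i).
  rewrite -ball_normE /= distrC ltr_distl.
  have := yq j; rewrite !mxE => /andP[ly yh].
  have /andP[lxj _] := xlo j; have /andP[_ hxj] := xhi j.
  by rewrite (lt_trans lxj ly) (le_lt_trans yh hxj).
apply: (@countable_bigcupT_measurable _
  (caratheodory_type (@lebesgue_rV R n.+1))).
  exact: countableP.
move=> q; case: ifP => _; first exact: caratheodory_box.
exact: caratheodory_measurable_set0.
Qed.

Lemma caratheodory_closed n (F : set 'rV[R]_n.+1) :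
  closed F -> lebesgue_rV.-caratheodory F.
Proof.
move=> cF; rewrite -(setCK F); apply: caratheodory_measurable_setC.
by apply: caratheodory_open; rewrite openC.
Qed.

Lemma lebesgue_rV_compact n (K : set 'rV[R]_n.+1) :
  compact K -> lebesgue_rV K < +oo.
Proof.
move=> /compact_bounded[M [_ /(_ (M + 1)%R)]].
rewrite ltrDl ltr01 => /(_ isT) KM.
(* The lower corner lies strictly below [-(M + 1)] because boxes omit their left faces. *)
apply: le_lt_trans (ltry (box_volume (const_mx (- (M + 1 + 1)))%R
  (const_mx (M + 1)%R : 'rV[R]_n.+1))).
apply: le_trans (lebesgue_rV_box _ _); apply: le_lebesgue_rV => x /KM /= xM i.
have : (`|x 0 i| <= M + 1)%R.
  apply: le_trans xM; rewrite [leRHS]/Num.norm/= mx_normrE.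
  exact: (le_bigmax _ (fun j => `|x j.1 j.2|)%R (0%R, i)).
rewrite !mxE ler_norml => /andP[xl ->]; rewrite andbT.
by apply: lt_le_trans xl; rewrite ltrN2 ltrDl.
Qed.

End LebesgueOuterMeasure.

(** * Closed sublevel sets, Bernoulli's inequality and a bound on the sup norm *)

Lemma closed_sublevel {R : realType} {T : topologicalType} (K : set T)
    (f : T -> R) (t : R) : closed K ->
  (forall x, K x -> {for x, continuous f}) ->
  closed [set x | K x /\ `|f x| <= t].
Proof.
move=> cK fc x clx.
have Kx : K x by apply: cK; apply: (closureS _ clx) => y [].
split=> //=; rewrite leNgt; apply/negP => tfx.
(* Continuity at [x] makes [|f| > t] on a neighbourhood of [x], which must meet the sublevel set
   since [x] is in its closure. *)
have /cvgr_norm_gt/(_ _ tfx) nfx : f y @[y --> x] --> f x by exact: fc.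
have [y [[_ fy] /=]] := clx _ nfx.
by rewrite ltNge fy.
Qed.

(** For [p < 1] this is Young's inequality for the product of [x ^ p] and 1, with conjugate
    exponents [1 / p] and [1 / (1 - p)]. *)
Lemma powR_bernoulli_le1 (R : realType) (x p : R) :
  0 <= x -> 0 < p <= 1 -> x `^ p <= 1 + p * (x - 1).
Proof.
move=> x0 /andP[p0]; rewrite le_eqVlt => /predU1P[->|p1].
  by rewrite powRr1// mul1r addrC subrK.
have := @conjugate_powR R (x `^ p) 1 p^-1 (1 - p)^-1 (powR_ge0 _ _) ler01.
rewrite !invr_gt0 subr_gt0 !invrK -powRrM divff ?gt_eqF// powRr1// powR1.
move=> /(_ p0 p1); rewrite addrC subrK => /(_ erefl).
by rewrite mulr1 mul1r mulrBr mulr1 mulrC addrCA.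
Qed.

Lemma norm_on_le_const (R : realType) n (E : set 'rV[R]_n)
    (f : 'rV[R]_n -> R) (t : R) : E !=set0 -> (forall x, E x -> `|f x| <= t) ->
  norm_on E (fun x => const_mx (f x) : 'rV[R]_1) <= t.
Proof.
move=> [x Ex] ft; apply: ge_sup.
  by exists (\sum_(i < 1) `|f x|), x => //; apply: eq_bigr => i _; rewrite mxE.
by move=> _ [y Ey <-]; rewrite big_ord1 mxE ft.
Qed.

Theorem theorem7p2 (R : realType) (n : nat) (hn : (1 <= n)%N)
  (* a fixed interpolant for each weight *)
  (tmu : (nat -> R) -> R -> R)
  (htmu : forall mu, admissible_weight mu -> interpolates mu (tmu mu))
  (L : set 'rV[R]_n) (hL : convex_body L)
  (* d is the degree of the collection fixed for K *)
  (K : set 'rV[R]_n) (d : nat) (hK : admissible_set d K)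
  (hd : convex_body K -> d = 1%N) (hKL : K `<=` L)
  (nu : R) (hnu : remez_constant tmu d K nu)
  (mu : nat -> R) (hmu : admissible_weight mu)
  (hmuj : forall j, (1 <= j)%N -> j%:R <= mu j)
  (M0 b0 : R) (hb0 : 0 < b0) (hM0 : b0 < M0)
  (hadm : admissible_tuple mu M0 (a_const d K) b0)
  (N : nat) (hN : N = degree_N mu M0 (a_const d K) b0)
  (f : 'rV[R]_n -> R)
  (hf : smooth mu N M0 L (fun x => const_mx (f x) : 'rV[R]_1))
  (hfK : b0 <= norm_on K (fun x => const_mx (f x) : 'rV[R]_1))
  (t : R) (ht : 0 < t) :
  (lebesgue_rV [set x | K x /\ (`|f x| <= t)%R] <=
    (fine (lebesgue_rV K) / nu *
     (C_const (tmu mu) N * t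
        / norm_on K (fun x => const_mx (f x) : 'rV[R]_1)) `^ N%:R^-1)%:E)%E.
Proof.
destruct n as [|n]; first by [].
set E := [set x | K x /\ `|f x| <= t]; set F := norm_on K _ in hfK *.
have F0 : 0 < F by exact: lt_le_trans hfK.
have /andP[nu0 nu1] : 0 < nu <= 1 by case: hnu.
have C0 : 0 < C_const (tmu mu) N by rewrite exprn_gt0// mulr_gt0// expR_gt0.
have cK : compact K by case: hK.
have EK : E `<=` K by move=> x [].
have Kfin : lebesgue_rV K \is a fin_num.
  by rewrite ge0_fin_numE ?lebesgue_rV_ge0// lebesgue_rV_compact.
have Efin : lebesgue_rV E \is a fin_num.
  rewrite ge0_fin_numE ?lebesgue_rV_ge0//.
  exact: le_lt_trans (le_lebesgue_rV EK) (lebesgue_rV_compact cK).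
have fcts x : K x -> {for x, continuous f}.
  (* The empty list of derivatives in [class_C] gives continuity of [f] itself. *)
  move=> Kx; have [[U [_ LU /(_ 0) CU]] _] := hf.
  have [+ _] := CU [::] isT x (LU _ (hKL _ Kx)).
  by rewrite /= (_ : (fun x0 => _) = f)//; apply/funext => y; rewrite mxE.
have mE : lebesgue_rV.-caratheodory E.
  apply: caratheodory_closed; apply: closed_sublevel => //.
  exact: compact_closed (@norm_hausdorff _ _) cK.
rewrite -(fineK Efin) lee_fin.
set V := fine (lebesgue_rV K); set v := fine (lebesgue_rV E).
have v0 : 0 <= v by exact: fine_ge0 (lebesgue_rV_ge0 _).
have vV : v <= V by apply: fine_le => //; exact: le_lebesgue_rV.
have V0 : 0 <= V by exact: le_trans vV.
have [N0|N0] := posnP N.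
  (* Here N^-1 = 0, and the bound is |K| / nu. *)
  rewrite N0 invr0 powRr0 mulr1 (le_trans vV)// ler_peMr//.
  by rewrite invf_ge1.
(* The Remez inequality requires positive measure; for [v <= 0] the nonnegative right-hand side
   suffices. *)
have [{}v0|v_le0] := ltP 0 v; last first.
  by rewrite (le_trans v_le0)// mulr_ge0 ?powR_ge0// divr_ge0// ltW.
have {}V0 : 0 < V by exact: lt_le_trans vV.
pose r := 1 - ((V - v) / V) `^ nu.
have rge : nu * (v / V) <= r.
  have := @powR_bernoulli_le1 _ ((V - v) / V) nu.
  rewrite divr_ge0 ?subr_ge0 ?(ltW V0)// nu0 nu1 => /(_ isT isT).
  have -> : (V - v) / V - 1 = - (v / V).
    by rewrite mulrBl divff ?gt_eqF// addrAC subrr add0r.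
  by rewrite mulrN lerBrDl -lerBrDr.
have r0 : 0 < r by apply: lt_le_trans rge; rewrite mulr_gt0// divr_gt0.
(* Dividing through by [V ^ nu] turns the Remez factor into exactly [1 / r]. *)
have rV : V `^ nu / (V `^ nu - (V - v) `^ nu) = r^-1.
  have -> : (V - v) `^ nu = ((V - v) / V) `^ nu * V `^ nu.
    by rewrite -powRM ?divr_ge0 ?subr_ge0 ?(ltW V0)// divfK// gt_eqF.
  rewrite -{2}(mul1r (V `^ nu)) -mulrBl invfM mulrCA divff ?mulr1//.
  by rewrite gt_eqF// powR_gt0.
have Fle : F <= C_const (tmu mu) N * r ^- N * t.
  have [_ _ /(_ L mu M0 b0 1%N (fun x => const_mx (f x)) E)] := hnu.
  rewrite !mul1r -hN => /(_ hL hKL hmu hmuj hb0 hM0 isT hadm hf hfK mE EK).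
  have lE : (0 < lebesgue_rV E)%E by rewrite -(fineK Efin) lte_fin.
  move=> /(_ lE) /le_trans; apply.
  rewrite mul1r -/V -/v rV exprVn ler_wpM2l//.
    by rewrite ltW// mulr_gt0// invr_gt0 exprn_gt0.
  apply: norm_on_le_const => [|x []//].
  (* Positive measure makes [E] nonempty, so its supremum is bounded by [t]. *)
  apply/set0P/eqP => E0; move: lE.
  by rewrite E0 lebesgue_rV0 ltxx.
have rN : r ^+ N <= C_const (tmu mu) N * t / F.
  rewrite ler_pdivlMr// mulrC -ler_pdivlMr ?exprn_gt0//.
  by rewrite mulrAC.
have rle : r <= (C_const (tmu mu) N * t / F) `^ N%:R^-1.
  (* Taking the [N]-th root is legitimate as [N > 0] and [r > 0]. *)
  have -> : r = (r ^+ N) `^ N%:R^-1.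
    by rewrite -powR_mulrn 1?ltW// -powRrM divff ?powRr1 ?pnatr_eq0 -?lt0n// ltW.
  apply: ge0_ler_powR => //; rewrite ?invr_ge0 ?ler0n// nnegrE ?exprn_ge0 ?ltW//.
  by rewrite divr_gt0// mulr_gt0.
(* The goal becomes [nu v <= V X] with [X] the [N]-th root; it follows from [nu v / V <= r <= X]
   multiplied by [V]. *)
rewrite mulrAC ler_pdivlMr// mulrC.
apply: le_trans (ler_wpM2l (ltW V0) rle).
apply: le_trans (ler_wpM2l (ltW V0) rge).
by rewrite mulrCA [V * _]mulrC divfK// gt_eqF.
Qed.
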